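(* Let $\sigma, \tau$ be polygonal curves in $\mathbb{R}^d$ with vertices $v^\sigma_1, \dots, v^\sigma_{\lvert \sigma \rvert}$, respectively $v^\tau_1, \dots, v^\tau_{\lvert \tau \rvert}$. There is a set $P'\subset\mathbb{R}^d$ of points determined by $\sigma$ and $\tau$ (i.e. depending only on $\sigma$ and $\tau$) with $\lvert P' \rvert \in O(\lvert \sigma \rvert^2 \cdot \lvert \tau \rvert + \lvert \tau \rvert^2 \cdot \lvert \sigma \rvert)$ (with an absolute hidden constant) such that the following holds. Let $\epsilon\in(0,1)$ and let $f\colon\mathbb{R}^d\to\mathbb{R}^{d'}$ be a linear $(1 \pm \epsilon)$-embedding for $P = \{v^\sigma_1, \dots, v^\sigma_{\lvert \sigma \rvert}, v^\tau_1, \dots, v^\tau_{\lvert \tau \rvert} \} \cup P'$, and let $\sigma'$ and $\tau'$ be the polygonal curves with vertices $f(v^\sigma_1), \dots, f(v^\sigma_{\lvert \sigma \rvert})$, respectively $f(v^\tau_1), \dots, f(v^\tau_{\lvert \tau \rvert})$. Then $d_{wF}(\sigma', \tau') \leq (1+\epsilon)\, d_{wF}(\sigma, \tau)$ and $d_F(\sigma', \tau') \leq (1+\epsilon)\, d_F(\sigma, \tau)$.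
   Context: A function $f\colon\mathbb{R}^d\to\mathbb{R}^{d'}$ is a $(1\pm\epsilon)$-embedding for $P\subset\mathbb{R}^d$, $\epsilon\in(0,1)$, if $(1-\epsilon)\|p-q\|\le\|f(p)-f(q)\|\le(1+\epsilon)\|p-q\|$ for all $p,q\in P$ (Euclidean norms). A curve is a continuous map $\tau\colon[0,1]\to\mathbb{R}^d$; it is polygonal if there are vertices $v_1,\dots,v_m$, no three consecutive on a line, and instants $0=t_1<\dots<t_m=1$ with $\tau(t_i)=v_i$ such that $\tau$ is linear between consecutive instants; $m=|\tau|$ is its complexity. The image curves $\sigma',\tau'$ are piecewise linear through the listed vertices (non-collinearity not required of them). The weak Fréchet distance is $d_{wF}(\sigma,\tau)=\inf_{a,b}\max_{t\in[0,1]}\|\sigma(a(t))-\tau(b(t))\|$ over continuous $a,b\colon[0,1]\to[0,1]$ with $a(0)=b(0)=0$, $a(1)=b(1)=1$; the Fréchet distance $d_F(\sigma,\tau)$ is the same infimum over continuous bijections $a,b$ with $a(0)=b(0)=0$, $a(1)=b(1)=1$. *)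

(* Defs.v *)
From HB Require Import structures.
From mathcomp Require Import all_boot all_order all_algebra finmap.
From mathcomp Require Import all_classical all_reals all_analysis.

Set Implicit Arguments.
Unset Strict Implicit.
Unset Printing Implicit Defensive.

Import Order.TTheory GRing.Theory Num.Theory.
Import numFieldNormedType.Exports.

Local Open Scope classical_set_scope.
Local Open Scope ring_scope.

(* The library norm `|v| on row vectors is the sup norm; it induces the same
   topology as the Euclidean norm below. *)
Definition enorm (R : realType) (d : nat) (v : 'rV[R]_d) : R :=
  Num.sqrt (\sum_(i < d) v 0 i ^+ 2).

Definition is_embedding (R : realType) (d d' : nat) (eps : R)
    (P : set 'rV[R]_d) (f : 'rV[R]_d -> 'rV[R]_d') : Prop :=
  forall p q, P p -> P q ->
    (1 - eps) * enorm (p - q) <= enorm (f p - f q) <= (1 + eps) * enorm (p - q).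

(* A curve is a total function on R of which only the restriction to [0, 1] is
   ever used. *)
Definition is_curve (R : realType) (d : nat) (tau : R -> 'rV[R]_d) : Prop :=
  {within `[0, 1], continuous tau}.

Definition collinear (R : realType) (d : nat) (p q r : 'rV[R]_d) : Prop :=
  exists a u : 'rV[R]_d, u != 0 /\
    forall x, x \in [:: p; q; r] -> exists s : R, x = a + s *: u.

(* Vertices and instants are indexed from 0. The conditions t_0 = 0 and
   t_(size vs - 1) = 1 force size vs >= 2. *)
Definition polyline (R : realType) (d : nat) (tau : R -> 'rV[R]_d)
    (vs : seq 'rV[R]_d) : Prop :=
  is_curve tau /\
  exists t : seq R,
    [/\ size t = size vs,
        sorted <%R t,
        t`_0 = 0 /\ t`_(size vs).-1 = 1,
        forall i, (i < size vs)%N -> tau t`_i = vs`_i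
      & forall i, (i.+1 < size vs)%N -> forall l : R, 0 <= l <= 1 ->
          tau ((1 - l) * t`_i + l * t`_i.+1)
          = (1 - l) *: tau t`_i + l *: tau t`_i.+1].

Definition polygonal (R : realType) (d : nat) (tau : R -> 'rV[R]_d)
    (vs : seq 'rV[R]_d) : Prop :=
  polyline tau vs /\
  forall i, (i.+2 < size vs)%N -> ~ collinear vs`_i vs`_i.+1 vs`_i.+2.

Definition weak_reparam (R : realType) (a : R -> R) : Prop :=
  [/\ {within `[0, 1], continuous a},
      set_fun `[0, 1] `[0, 1] a, a 0 = 0 & a 1 = 1].

Definition bij_reparam (R : realType) (a : R -> R) : Prop :=
  [/\ {within `[0, 1], continuous a},
      set_bij `[0, 1] `[0, 1] a, a 0 = 0 & a 1 = 1].

(* For curves and reparametrizations this supremum is a maximum, the function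
   being continuous on the compact [0, 1]. *)
Definition matching_cost (R : realType) (d : nat) (sigma tau : R -> 'rV[R]_d)
    (a b : R -> R) : R :=
  sup [set enorm (sigma (a t) - tau (b t)) | t in `[0, 1]].

Definition weak_frechet (R : realType) (d : nat) (sigma tau : R -> 'rV[R]_d)
    : R :=
  inf [set r | exists a b : R -> R,
    [/\ weak_reparam a, weak_reparam b & r = matching_cost sigma tau a b]].

Definition frechet (R : realType) (d : nat) (sigma tau : R -> 'rV[R]_d) : R :=
  inf [set r | exists a b : R -> R,
    [/\ bij_reparam a, bij_reparam b & r = matching_cost sigma tau a b]].

(* Main.v *)
(* Parametrize the two curves by [0, p] and [0, q], one unit per edge. On a
   product of two edges (a cell) a path that is affine in both parameters moves
   the difference vector affinely, so its cost is attained at its ends. Hence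
   both distances are computed by cell paths, i.e. finite sequences of parameter
   pairs in which consecutive pairs share a cell. A reparametrization yields a
   cell path of bounded length and no larger cost: in the weak case, connectedness
   of [0, 1] connects the first cell to the last one in the graph of cells, and
   loops can be removed; in the bijective case, stop at the times when either
   curve visits a vertex. The cell paths of a given length form a compact set, so
   one of minimal cost exists. Taking as P' the points visited by the two optimal
   cell paths, a linear embedding f stretches each of their costs by at most
   1 + eps, and linearity carries the cell paths over to the image curves. *)
Require Import Defs.
From mathcomp Require Import all_boot all_order all_algebra finmap.
From mathcomp Require Import all_classical all_reals all_analysis.
From mathcomp Require Import ring lra zify.

Import Order.TTheory GRing.Theory Num.Theory.
Import numFieldNormedType.Exports.

Set Implicit Arguments.
Unset Strict Implicit.

Local Open Scope classical_set_scope.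
Local Open Scope ring_scope.

Lemma continuous_sum (R : realType) (T : topologicalType) (V : normedModType R)
    n (F : 'I_n -> T -> V) :
  (forall i, continuous (F i)) -> continuous (fun x => \sum_(i < n) F i x).
Proof.
move=> cF x; apply: cvg_big => [|i _]; first exact: add_continuous.
exact: cF.
Qed.

(** * Euclidean norm: Cauchy-Schwarz, convexity, continuity *)

Section EuclideanNorm.
Variables (R : realType) (d : nat).
Implicit Types u v : 'rV[R]_d.

Lemma enorm_ge0 v : 0 <= enorm v.
Proof. exact: sqrtr_ge0. Qed.

Lemma enorm0 : enorm (0 : 'rV[R]_d) = 0.
Proof. by rewrite /enorm big1 ?sqrtr0// => i _; rewrite mxE expr0n. Qed.

Lemma sqr_enorm v : enorm v ^+ 2 = \sum_(i < d) v 0 i ^+ 2.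
Proof. by rewrite sqr_sqrtr// sumr_ge0// => i _; exact: sqr_ge0. Qed.

Lemma enormZ (k : R) v : enorm (k *: v) = `|k| * enorm v.
Proof.
rewrite /enorm; under eq_bigr do rewrite mxE exprMn.
by rewrite -mulr_sumr sqrtrM ?sqr_ge0// sqrtr_sqr.
Qed.

Lemma enormN v : enorm (- v) = enorm v.
Proof. by rewrite -scaleN1r enormZ normrN1 mul1r. Qed.

(** Lagrange's identity: the double sum of squares of [u 0 i * v 0 j - u 0 j * v 0 i] is twice the
    defect in the squared inequality. *)
Lemma dot_le_enorm u v : \sum_(i < d) u 0 i * v 0 i <= enorm u * enorm v.
Proof.
apply: le_trans (ler_norm _) _.
rewrite -(ler_pXn2r (n := 2)) ?nnegrE ?mulr_ge0 ?enorm_ge0//.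
rewrite real_normK ?num_real// exprMn !sqr_enorm -subr_ge0.
have : 0 <= \sum_(i < d) \sum_(j < d) (u 0 i * v 0 j - u 0 j * v 0 i) ^+ 2.
  by apply: sumr_ge0 => i _; apply: sumr_ge0 => j _; exact: sqr_ge0.
suff -> : \sum_(i < d) \sum_(j < d) (u 0 i * v 0 j - u 0 j * v 0 i) ^+ 2 =
  ((\sum_(i < d) u 0 i ^+ 2) * (\sum_(i < d) v 0 i ^+ 2) -
   (\sum_(i < d) u 0 i * v 0 i) ^+ 2) *+ 2 by rewrite pmulrn_lge0.
pose a i := u 0 i ^+ 2; pose b i := v 0 i ^+ 2; pose c i := u 0 i * v 0 i.
transitivity (\sum_(i < d) \sum_(j < d) (a i * b j - c i * c j)
            + \sum_(i < d) \sum_(j < d) (b i * a j - c i * c j)).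
  rewrite -big_split; apply: eq_bigr => i _; rewrite -big_split.
  by apply: eq_bigr => j _; rewrite /a /b /c/=; ring.
have dist (x y : 'I_d -> R) : \sum_i \sum_j (x i * y j - c i * c j) =
    (\sum_i x i) * (\sum_i y i) - (\sum_i c i) ^+ 2.
  rewrite expr2 !mulr_suml -sumrB; apply: eq_bigr => i _.
  by rewrite !mulr_sumr -sumrB.
by rewrite !dist mulr2n (mulrC (\sum_i b i)).
Qed.

Lemma enormD u v : enorm (u + v) <= enorm u + enorm v.
Proof.
rewrite -(ler_pXn2r (n := 2)) ?nnegrE ?addr_ge0 ?enorm_ge0//.
rewrite sqrrD !sqr_enorm.
under eq_bigr do rewrite mxE sqrrD.
rewrite !big_split/= lerD2r lerD2l.
by rewrite -mulr2n lerMn2r/=; exact: dot_le_enorm.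
Qed.

Lemma enorm_sum n (F : 'I_n -> 'rV[R]_d) :
  enorm (\sum_(i < n) F i) <= \sum_(i < n) enorm (F i).
Proof.
elim/big_ind2 : _ => // [|x r y s xr ys]; first by rewrite enorm0.
by apply: le_trans (enormD _ _) _; exact: lerD.
Qed.

Lemma enorm_conv (l : R) u v : 0 <= l <= 1 ->
  enorm ((1 - l) *: u + l *: v) <= Num.max (enorm u) (enorm v).
Proof.
move=> /andP[l0 l1]; apply: le_trans (enormD _ _) _.
rewrite !enormZ !ger0_norm ?subr_ge0//.
set m := Num.max _ _.
have um : enorm u <= m by rewrite le_max lexx.
have vm : enorm v <= m by rewrite le_max lexx orbT.
by nra.
Qed.

Lemma continuous_enorm : continuous (@enorm R d).
Proof.
move=> v; apply: (@continuous_comp _ _ _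
  (fun v : 'rV[R]_d => \sum_(i < d) v 0 i ^+ 2)); last exact: sqrt_continuous.
apply: continuous_sum => i {}v.
apply: (@continuous_comp _ _ _ (fun v : 'rV[R]_d => v 0 i) (fun x => x ^+ 2)).
  exact: coord_continuous.
exact: exprn_continuous.
Qed.

End EuclideanNorm.

(** * Truncation to the unit interval *)

Section Clamp.
Variable R : realType.
Implicit Types x y : R.

(** Sums of such ramps describe polygonal curves and their time changes by one formula on all of
    [R], so continuity and Lipschitz bounds need no gluing. *)
Definition clamp01 x : R := Num.max 0 (Num.min 1 x).

Lemma clamp01_itv x : 0 <= clamp01 x <= 1.
Proof. by rewrite le_max lexx ge_max ler01 ge_min lexx. Qed.

Lemma clamp01_le0 x : x <= 0 -> clamp01 x = 0.
Proof. by move=> x0; rewrite /clamp01 min_r ?max_l// (le_trans x0). Qed.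

Lemma clamp01_ge1 x : 1 <= x -> clamp01 x = 1.
Proof. by move=> x1; rewrite /clamp01 min_l// max_r. Qed.

Lemma clamp01_id x : 0 <= x <= 1 -> clamp01 x = x.
Proof. by case/andP=> x0 x1; rewrite /clamp01 min_r// max_r. Qed.

Lemma clamp01_cases x : [\/ x <= 0 /\ clamp01 x = 0,
  0 <= x <= 1 /\ clamp01 x = x | 1 <= x /\ clamp01 x = 1].
Proof.
have [x0|x0] := leP x 0; first by apply: Or31; rewrite clamp01_le0.
have [x1|x1] := leP x 1.
  by apply: Or32; rewrite clamp01_id ?(ltW x0)//.
by apply: Or33; rewrite clamp01_ge1 ?(ltW x1).
Qed.

Lemma clamp01_le x y : x <= y -> clamp01 x <= clamp01 y.
Proof.
move=> xy; case: (clamp01_cases x) => -[hx ->];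
  case: (clamp01_cases y) => -[hy ->]; lra.
Qed.

Lemma clamp01_lip x y : `|clamp01 x - clamp01 y| <= `|x - y|.
Proof.
wlog xy : x y / y <= x.
  by move=> h; have [/h//|/ltW/h] := leP y x; rewrite distrC (distrC y).
rewrite !ger0_norm ?subr_ge0 ?clamp01_le//.
case: (clamp01_cases x) => -[hx ->];
  case: (clamp01_cases y) => -[hy ->]; lra.
Qed.

Lemma continuous_clamp01 : continuous clamp01.
Proof.
move=> x; apply: (@continuous_max _ _ (fun=> 0)); first exact: cvg_cst.
by apply: continuous_min; [exact: cvg_cst|exact: cvg_id].
Qed.

End Clamp.

(** * Polygonal curves with one unit of parameter per edge *)

Section Gam.
Variable R : realType.

(** Induction on [n]: either the last interval works, or [x < s n], and then [s n] lying outside the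
    open interval from [x] to [y] forces [y <= s n]. *)
Lemma find_gap n (s : nat -> R) x y : (0 < n)%N -> s 0%N <= x -> y <= s n ->
  x <= y -> (forall k, (k <= n)%N -> ~ (x < s k < y)) ->
  exists2 i, (i < n)%N & s i <= x /\ y <= s i.+1.
Proof.
move=> n0 s0 sn xy; elim: n n0 sn => // n IH _ sn gap.
have [snx|xsn] := leP (s n) x; first by exists n.
have ysn : y <= s n.
  by rewrite leNgt; apply/negP => syn; apply: (gap n); rewrite ?leqW// xsn syn.
have n0 : (0 < n)%N by case: n xsn {IH sn gap ysn} => //; lra.
have [k /leqW|i ni h] := IH n0 ysn; first exact: gap.
by exists i => //; exact: ltnW.
Qed.

Lemma find_cell n (s : nat -> R) x : (0 < n)%N -> s 0%N <= x <= s n ->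
  exists2 i, (i < n)%N & s i <= x <= s i.+1.
Proof.
move=> n0 /andP[sx xs].
have [//|k _ /andP[]|i ni [h1 h2]] := find_gap n0 sx xs; first lra.
by exists i => //; apply/andP.
Qed.

Lemma find_unit n (x : R) : (0 < n)%N -> 0 <= x <= n%:R ->
  exists2 i, (i < n)%N & exists2 l, 0 <= l <= 1 & x = i%:R + l.
Proof.
move=> n0 hx; have [i ni h] := @find_cell n (fun k => k%:R) x n0 hx.
exists i => //; exists (x - i%:R); last by rewrite addrC subrK.
by move: h; rewrite -natr1; lra.
Qed.

(* The polygonal curve with vertices v 0, ..., v n, parametrized by [0, n]. *)
Definition gam (V : lmodType R) (v : nat -> V) n (x : R) : V :=
  v 0%N + \sum_(i < n) clamp01 (x - i%:R) *: (v i.+1 - v i).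

Section Module.
Variable V : lmodType R.
Implicit Type v : nat -> V.

Lemma gamS v n x : gam v n.+1 x = gam v n x + clamp01 (x - n%:R) *: (v n.+1 - v n).
Proof. by rewrite /gam big_ord_recr addrA. Qed.

Lemma gam_ge v n x : n%:R <= x -> gam v n x = v n.
Proof.
elim: n => [|n IH] nx; first by rewrite /gam big_ord0 addr0.
move: nx; rewrite -natr1 => nx.
by rewrite gamS IH ?clamp01_ge1 ?scale1r ?subrKC//; lra.
Qed.

(** The ramps before edge [i] are saturated and telescope to [v i]; those after it still vanish. *)
Lemma gam_cell v n i l : (i < n)%N -> 0 <= l <= 1 ->
  gam v n (i%:R + l) = v i + l *: (v i.+1 - v i).
Proof.
elim: n => // n IH; rewrite ltnS leq_eqVlt => /predU1P[->|ni] hl.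
  rewrite gamS gam_ge; last by lra.
  by rewrite (addrC n%:R) addrK clamp01_id.
rewrite gamS IH// clamp01_le0 ?scale0r ?addr0//.
have : i%:R + 1 <= n%:R :> R by rewrite natr1 ler_nat.
lra.
Qed.

Lemma gam_nat v n i : (i <= n)%N -> gam v n i%:R = v i.
Proof.
rewrite leq_eqVlt => /predU1P[->|ni]; first exact: gam_ge.
by rewrite -[i%:R]addr0 gam_cell ?lexx ?ler01// scale0r addr0.
Qed.

Lemma gam_conv v n i x y l : (i < n)%N -> i%:R <= x <= i%:R + 1 ->
  i%:R <= y <= i%:R + 1 -> 0 <= l <= 1 ->
  gam v n ((1 - l) * x + l * y) = (1 - l) *: gam v n x + l *: gam v n y.
Proof.
move=> ni hx hy hl.
have [a ha ->] : exists2 a, 0 <= a <= 1 & x = i%:R + a.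
  by exists (x - i%:R); lra.
have [b hb ->] : exists2 b, 0 <= b <= 1 & y = i%:R + b.
  by exists (y - i%:R); lra.
have -> : (1 - l) * (i%:R + a) + l * (i%:R + b) =
  i%:R + ((1 - l) * a + l * b) by ring.
rewrite !gam_cell//; last by nra.
move: (v i.+1 - v i) => D.
rewrite !scalerDr !scalerA addrACA -scalerDl -scalerDl.
by rewrite subrK scale1r.
Qed.

End Module.

Lemma gam_linear (V W : lmodType R) (f : {linear V -> W}) (v : nat -> V) n x :
  f (gam v n x) = gam (f \o v) n x.
Proof.
rewrite /gam raddfD raddf_sum /=; congr (_ + _).
by apply: eq_bigr => i _; rewrite linearZ raddfB.
Qed.

Lemma eq_gam (V : lmodType R) (v w : nat -> V) n x :
  (forall i, (i <= n)%N -> v i = w i) -> gam v n x = gam w n x.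
Proof.
move=> vw; rewrite /gam vw//; congr (_ + _); apply: eq_bigr => i _.
by rewrite !vw// ltnW.
Qed.

Lemma gam_continuous (V : normedModType R) (v : nat -> V) n :
  continuous (gam v n : R -> V).
Proof.
move=> x; apply: cvgD; first exact: cvg_cst.
move: x; apply: continuous_sum => i x.
apply: cvgZr_tmp.
have /continuous_comp : {for x, continuous (fun x : R => x - i%:R)}.
  by apply: cvgB; [exact: cvg_id|exact: cvg_cst].
by apply; exact: continuous_clamp01.
Qed.

Section Euclidean.
Variables (d : nat) (v : nat -> 'rV[R]_d) (n : nat).

(** Boundedness guarantees that the suprema defining matching costs are genuine. *)
Lemma gam_bounded x :
  enorm (gam v n x) <= enorm (v 0%N) + \sum_(i < n) enorm (v i.+1 - v i).
Proof.
apply: le_trans (enormD _ _) _; rewrite lerD2l.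
apply: le_trans (enorm_sum _) _; apply: ler_sum => i _.
have /andP[c0 c1] := clamp01_itv (x - i%:R).
by rewrite enormZ ger0_norm// ler_piMl// enorm_ge0.
Qed.

(** Each ramp is 1-Lipschitz, so the total edge length is a Lipschitz constant, crude but sufficient
    for a perturbation argument. *)
Lemma gam_lipschitz x y : enorm (gam v n x - gam v n y) <=
  (\sum_(i < n) enorm (v i.+1 - v i)) * `|x - y|.
Proof.
rewrite /gam opprD addrACA subrr add0r -sumrB mulr_suml.
apply: le_trans (enorm_sum _) _; apply: ler_sum => i _.
rewrite -scalerBl enormZ mulrC ler_wpM2l ?enorm_ge0//.
by apply: le_trans (clamp01_lip _ _) _; rewrite opprB addrA subrK.
Qed.

End Euclidean.

Lemma gam_le (v : nat -> R) n x y : (forall i, (i < n)%N -> v i <= v i.+1) ->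
  x <= y -> gam v n x <= gam v n y.
Proof.
move=> hv xy; rewrite lerD2l; apply: ler_sum => i _.
by apply: ler_wpM2r; rewrite ?subr_ge0 ?hv// clamp01_le// lerD2r.
Qed.

(* The inverse of [gam t n] when t increases from t 0 = 0 to t n = 1. *)
Definition theta (t : nat -> R) n (x : R) : R :=
  \sum_(i < n) clamp01 ((x - t i) / (t i.+1 - t i)).

Section Theta.
Variable t : nat -> R.

Lemma thetaS n x :
  theta t n.+1 x = theta t n x + clamp01 ((x - t n) / (t n.+1 - t n)).
Proof. exact: big_ord_recr. Qed.

Lemma theta_le n x y : (forall i, (i < n)%N -> t i < t i.+1) ->
  x <= y -> theta t n x <= theta t n y.
Proof.
move=> ht xy; apply: ler_sum => i _; apply: clamp01_le.
by rewrite ler_pM2r ?lerD2r// invr_gt0 subr_gt0 ht.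
Qed.

Lemma theta_continuous n : continuous (theta t n).
Proof.
move=> x; move: x; apply: continuous_sum => i x.
have /continuous_comp :
    {for x, continuous (fun x : R => (x - t i) / (t i.+1 - t i))}.
  apply: cvgMr_tmp.
  by apply: cvgB; [exact: cvg_id|exact: cvg_cst].
by apply; exact: continuous_clamp01.
Qed.

Lemma incr_le n i j : (forall i, (i < n)%N -> t i < t i.+1) ->
  (i <= j <= n)%N -> t i <= t j.
Proof.
move=> ht; elim: j => [|j IH] /andP[ij jn].
  by move: ij; rewrite leqn0 => /eqP->.
move: ij; rewrite leq_eqVlt => /predU1P[->//|ij].
by apply: le_trans (ltW (ht _ jn)); rewrite IH// -ltnS ij ltnW.
Qed.

Lemma theta_ge n x : (forall i, (i < n)%N -> t i < t i.+1) -> t n <= x ->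
  theta t n x = n%:R.
Proof.
elim: n => [|n IH] ht tx; first by rewrite /theta big_ord0.
have tn := ht n (ltnSn n).
rewrite thetaS IH; last lra; last by move=> i /ltnW; exact: ht.
by rewrite clamp01_ge1 ?natr1// ler_pdivlMr ?subr_gt0// mul1r lerD2r.
Qed.

(** Peeling off the last ramp: for the last edge all earlier ramps are saturated, for an earlier
    edge the last ramp is still 0. *)
Lemma theta_cell n i l : (forall i, (i < n)%N -> t i < t i.+1) ->
  (i < n)%N -> 0 <= l <= 1 ->
  theta t n ((1 - l) * t i + l * t i.+1) = i%:R + l.
Proof.
move=> + + hl; elim: n => // n IH ht.
have ht' k : (k < n)%N -> t k < t k.+1 by move/ltnW/ht.
have E j : (1 - l) * t j + l * t j.+1 = t j + l * (t j.+1 - t j) by ring.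
rewrite E; have tn := ht n (ltnSn n).
rewrite ltnS leq_eqVlt => /predU1P[->|ni].
  rewrite thetaS theta_ge//; last by nra.
  by rewrite addrAC subrr add0r mulfK ?clamp01_id// subr_eq0 gt_eqF.
rewrite thetaS -E IH// clamp01_le0 ?addr0//.
rewrite pmulr_lle0 ?invr_gt0 ?subr_gt0//.
have := ht _ (ltnW ni); have := @incr_le n i.+1 n ht'.
by rewrite ni leqnn E => /(_ isT); nra.
Qed.

End Theta.

End Gam.

(** * Matching costs and the two distances as infima *)

Section MatchingCost.
Variables (R : realType) (d : nat).
Implicit Types (sigma tau : R -> 'rV[R]_d) (a b : R -> R).

Lemma itv01 (t : R) : (t \in `[0, 1]) = (0 <= t <= 1).
Proof. by rewrite in_itv. Qed.

(** If the set of distances has no supremum, [sup] takes its default value 0. *)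
Lemma matching_cost_ge0 sigma tau a b : 0 <= matching_cost sigma tau a b.
Proof.
rewrite /matching_cost; set E := (X in sup X).
have [supE|/sup_out->//] := pselect (has_sup E).
have [_ [t /= t01 _]] := supE.1.
apply: le_trans (enorm_ge0 (sigma (a t) - tau (b t))) _.
by apply: sup_upper_bound => //; exists t.
Qed.

Lemma matching_cost_le sigma tau a b c :
  (forall t, 0 <= t <= 1 -> enorm (sigma (a t) - tau (b t)) <= c) ->
  matching_cost sigma tau a b <= c.
Proof.
move=> h; apply: ge_sup.
  by exists (enorm (sigma (a 0) - tau (b 0))), 0; rewrite //= in_itv/= lexx ler01.
by move=> _ [t /= t01 <-]; apply: h; rewrite -itv01.
Qed.

(** The bound [c] only ensures that the supremum is an upper bound; its value does not enter the
    conclusion. *)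
Lemma le_matching_cost sigma tau a b c t :
  (forall t, 0 <= t <= 1 -> enorm (sigma (a t) - tau (b t)) <= c) ->
  0 <= t <= 1 -> enorm (sigma (a t) - tau (b t)) <= matching_cost sigma tau a b.
Proof.
move=> h t01; apply: ub_le_sup.
  by exists c => _ [u /= u01 <-]; apply: h; rewrite -itv01.
by exists t => //=; rewrite itv01.
Qed.

Lemma weak_frechet_le sigma tau a b :
  weak_reparam a -> weak_reparam b ->
  weak_frechet sigma tau <= matching_cost sigma tau a b.
Proof.
move=> ha hb; apply: ge_inf; last by exists a, b.
by exists 0 => _ [a' [b' [_ _ ->]]]; exact: matching_cost_ge0.
Qed.

Lemma frechet_le sigma tau a b :
  bij_reparam a -> bij_reparam b ->
  frechet sigma tau <= matching_cost sigma tau a b.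
Proof.
move=> ha hb; apply: ge_inf; last by exists a, b.
by exists 0 => _ [a' [b' [_ _ ->]]]; exact: matching_cost_ge0.
Qed.

Lemma weak_reparam_id : weak_reparam (@id R).
Proof. by split => //; apply: continuous_subspaceT => x; exact: cvg_id. Qed.

Lemma bij_reparam_id : bij_reparam (@id R).
Proof.
split => //; first by apply: continuous_subspaceT => x; exact: cvg_id.
by split => // x; exists x.
Qed.

(** The identity reparametrizations show that the set of costs is nonempty, as a lower bound on its
    infimum requires. *)
Lemma le_weak_frechet sigma tau c :
  (forall a b, weak_reparam a -> weak_reparam b ->
     c <= matching_cost sigma tau a b) ->
  c <= weak_frechet sigma tau.
Proof.
move=> h; apply: lb_le_inf; last by move=> _ [a [b [ha hb ->]]]; exact: h.
by exists (matching_cost sigma tau id id), id, id; split => //;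
  exact: weak_reparam_id.
Qed.

Lemma le_frechet sigma tau c :
  (forall a b, bij_reparam a -> bij_reparam b ->
     c <= matching_cost sigma tau a b) ->
  c <= frechet sigma tau.
Proof.
move=> h; apply: lb_le_inf; last by move=> _ [a [b [ha hb ->]]]; exact: h.
by exists (matching_cost sigma tau id id), id, id; split => //;
  exact: bij_reparam_id.
Qed.

Lemma bij_weak_reparam a : bij_reparam a -> weak_reparam a.
Proof. by case=> ca [? _ _] a0 a1; split. Qed.

(** A continuous injection on a segment is monotone, and the end values 0 and 1 make it
    increasing. *)
Lemma bij_reparam_lt a s t : bij_reparam a -> 0 <= s -> s < t -> t <= 1 ->
  a s < a t.
Proof.
case=> ca [_ ia _] a0 a1 s0 st t1.
have mono : {in `[0, 1] &, {mono a : x y / x <= y}}.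
  apply: segment_continuous_inj_le => //; first by rewrite a0 a1 ler01.
  by move=> x y x01 y01; apply: ia; rewrite inE /=.
by rewrite (leW_mono_in mono)// itv01; lra.
Qed.

End MatchingCost.

(** * Passing between instants in [0, 1] and edge parameters in [0, n] *)

Section Instants.
Variable R : realType.
Variables (t : nat -> R) (n : nat).

Definition instants := [/\ (0 < n)%N, t 0%N = 0, t n = 1 &
  forall i, (i < n)%N -> t i < t i.+1].

Hypothesis tn : instants.

Let n0 : (0 < n)%N := let: And4 h _ _ _ := tn in h.
Let t0 : t 0%N = 0 := let: And4 _ h _ _ := tn in h.
Let t1 : t n = 1 := let: And4 _ _ h _ := tn in h.
Let t_lt i : (i < n)%N -> t i < t i.+1 := let: And4 _ _ _ h := tn in h i.

Lemma theta0 : theta t n 0 = 0.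
Proof.
have := @theta_cell _ t n 0 0 t_lt n0.
by rewrite t0 mulr0 mul0r !addr0 lexx ler01; exact.
Qed.

Lemma theta1 : theta t n 1 = n%:R.
Proof. by rewrite theta_ge// t1. Qed.

Lemma theta_itv x : 0 <= x <= 1 -> 0 <= theta t n x <= n%:R.
Proof. by move=> /andP[x0 x1]; rewrite -{1}theta0 -theta1 !theta_le. Qed.

Lemma gam0 : gam t n 0 = 0.
Proof. by rewrite (gam_nat _ (leq0n n)). Qed.

Lemma gam1 : gam t n n%:R = 1.
Proof. by rewrite gam_nat. Qed.

Lemma gam_itv y : 0 <= y <= n%:R -> 0 <= gam t n y <= 1.
Proof.
by move=> /andP[y0 y1]; rewrite -{1}gam0 -gam1 !gam_le// => i /t_lt/ltW.
Qed.

Lemma gamK y : 0 <= y <= n%:R -> theta t n (gam t n y) = y.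
Proof.
move=> /(find_unit n0)[i ni [l hl ->]].
rewrite gam_cell// -(theta_cell t_lt ni hl); congr theta.
by rewrite /GRing.scale/=; ring.
Qed.

(** Strictness comes from injectivity: [theta] recovers the argument. *)
Lemma gam_lt x y : 0 <= x -> x < y -> y <= n%:R -> gam t n x < gam t n y.
Proof.
move=> x0 xy yn; rewrite lt_neqAle gam_le ?(ltW xy) ?andbT//; last first.
  by move=> i /t_lt/ltW.
apply/eqP => /(congr1 (theta t n)); rewrite !gamK//; lra.
Qed.

Lemma weak_reparam_gam (alpha : R -> R) :
  continuous alpha -> alpha 0 = 0 -> alpha 1 = n%:R ->
  (forall x, 0 <= x <= 1 -> 0 <= alpha x <= n%:R) ->
  weak_reparam (gam t n \o alpha).
Proof.
move=> ca a0 a1 ha; split.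
- apply: continuous_subspaceT => x; apply: continuous_comp; first exact: ca.
  exact: gam_continuous.
- by move=> x; rewrite /= !itv01 => /ha/gam_itv.
- by rewrite /= a0 gam0.
- by rewrite /= a1 gam1.
Qed.

(** Strict monotonicity gives injectivity, the intermediate value theorem surjectivity. *)
Lemma bij_reparam_gam (alpha : R -> R) :
  continuous alpha -> alpha 0 = 0 -> alpha 1 = n%:R ->
  (forall x y, 0 <= x -> x < y -> y <= 1 -> alpha x < alpha y) ->
  bij_reparam (gam t n \o alpha).
Proof.
move=> ca a0 a1 alt.
have ale x y : 0 <= x -> x <= y -> y <= 1 -> alpha x <= alpha y.
  by move=> x0; rewrite le_eqVlt => /predU1P[->//|xy] y1; exact/ltW/alt.
have [//|cg fg g0 g1] := weak_reparam_gam ca a0 a1.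
  by move=> x /andP[x0 x1]; rewrite -{1}a0 -a1 !ale.
split=> //; split => //.
- have lt_inj x y : 0 <= x -> x < y -> y <= 1 ->
      (gam t n \o alpha) x < (gam t n \o alpha) y.
    move=> x0 xy y1; apply: gam_lt; [|exact: alt|].
      by rewrite -a0 ale//; lra.
    by rewrite -a1 ale//; lra.
  move=> x y; rewrite !inE/= !itv01 => /andP[x0 x1] /andP[y0 y1] /eqP.
  have [xy|xy|//] := ltgtP x y.
    by rewrite (lt_eqF (lt_inj x y _ _ _)).
  by rewrite (gt_eqF (lt_inj y x _ _ _)).
- move=> y; rewrite /= itv01 => y01.
  have [|x x01 <-] := IVT (v := y) (@ler01 R) cg; last by exists x.
  by rewrite g0 g1 min_l ?max_r.
Qed.

End Instants.

(** * Edge parametrization of a given polygonal curve *)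

Section Polyline.
Variables (R : realType) (d : nat) (tau : R -> 'rV[R]_d) (vs : seq 'rV[R]_d).
Hypothesis ptau : polyline tau vs.

(** On each edge all maps involved are affine, so agreement at the vertices suffices. The first
    identity turns reparametrizations into paths of edge parameters, the second turns such paths
    back. *)
Lemma polyline_param : exists2 t, instants t (size vs).-1 &
  (forall x, 0 <= x <= 1 ->
     tau x = gam (nth 0 vs) (size vs).-1 (theta t (size vs).-1 x)) /\
  (forall y, 0 <= y <= (size vs).-1%:R ->
     tau (gam t (size vs).-1 y) = gam (nth 0 vs) (size vs).-1 y).
Proof.
have [_ [ts [sz srt [ts0 ts1] tau_ts tau_lin]]] := ptau.
(* Without vertices the first and the last instant coincide, so 0 = 1; the same contradiction
   excludes a single vertex below. *)
case: (size vs) sz ts1 tau_ts tau_lin => [|n] sz ts1 tau_ts tau_lin.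
  by move/eqP: ts1; rewrite /= ts0 eq_sym oner_eq0.
rewrite /= in ts1 *.
have n0 : (0 < n)%N.
  by case: n ts1 {sz tau_ts tau_lin} => // /eqP; rewrite ts0 eq_sym oner_eq0.
have t_lt i : (i < n)%N -> ts`_i < ts`_i.+1.
  by move=> ni; apply: (sortedP 0 _) => //; rewrite sz.
have tn : instants (nth 0 ts) n by [].
exists (nth 0 ts) => //.
have tauE i l : (i < n)%N -> 0 <= l <= 1 ->
    tau ((1 - l) * ts`_i + l * ts`_i.+1) = gam (nth 0 vs) n (i%:R + l).
  move=> ni hl; rewrite tau_lin// !tau_ts// 1?ltnW// gam_cell//.
  by rewrite scalerBl scale1r scalerBr addrAC addrA.
split=> [x|y].
  rewrite -{1}ts0 -ts1 => /(find_cell n0)[i ni hi].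
  have ti := t_lt i ni.
  pose l := (x - ts`_i) / (ts`_i.+1 - ts`_i).
  have hl : 0 <= l <= 1.
    rewrite divr_ge0 ?ler_pdivrMr ?mul1r ?subr_gt0//; lra.
  have -> : x = (1 - l) * ts`_i + l * ts`_i.+1.
    by rewrite /l; field; rewrite subr_eq0 gt_eqF.
  by rewrite tauE// theta_cell.
move=> /(find_unit n0)[i ni [l hl ->]].
rewrite [X in tau X]gam_cell// -tauE//; congr tau.
by rewrite /GRing.scale/=; ring.
Qed.

End Polyline.

(** * Cell paths and their extraction from continuous paths *)

Section CellPath.
Variable R : realType.
Implicit Types (x y u : nat -> R) (p q M : nat) (mono : bool).

Definition same_cell n (s t : R) (i : 'I_n) : bool :=
  (i%:R <= s <= i%:R + 1) && (i%:R <= t <= i%:R + 1).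

(** One notion serves both distances: [mono] adds the monotonicity wanted for bijective
    reparametrizations. Only the indices up to [M] are constrained. *)
Definition cell_path mono p q M x y := [/\ x 0%N = 0 /\ y 0%N = 0,
  x M = p%:R /\ y M = q%:R,
  forall k, (k < M)%N -> exists c : 'I_p * 'I_q,
    same_cell (x k) (x k.+1) c.1 && same_cell (y k) (y k.+1) c.2
  & mono -> forall k, (k < M)%N -> x k <= x k.+1 /\ y k <= y k.+1].

Lemma cell_path_sym mono p q M x y :
  cell_path mono p q M x y -> cell_path mono q p M y x.
Proof.
case=> -[? ?] [? ?] st mn; split=> //.
  by move=> k /st[[i j] /andP[? ?]]; exists (j, i); apply/andP.
by move=> b k /(mn b)[].
Qed.

Lemma cell_path_itv mono p q M x y k : cell_path mono p q M x y ->
  (k <= M)%N -> 0 <= x k <= p%:R.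
Proof.
case=> _ [xM _] st _; rewrite leq_eqVlt => /predU1P[->|/st[[i j]]].
  by rewrite xM ler0n lexx.
move=> /andP[/andP[hi _] _]; have : i%:R + 1 <= p%:R :> R.
  by rewrite natr1 ler_nat.
have : 0 <= i%:R :> R by []; move: hi => /=; lra.
Qed.

Lemma gam_cell_path_itv mono p q M x y t : (0 < M)%N ->
  cell_path mono p q M x y -> 0 <= t <= M%:R -> 0 <= gam x M t <= p%:R.
Proof.
move=> M0 xy /(find_unit M0)[k kM [l hl ->]].
have := cell_path_itv xy kM; have := cell_path_itv xy (ltnW kM).
by rewrite gam_cell// /GRing.scale/=; nra.
Qed.

Lemma cell_path_cost mono p q M x y d (v w : nat -> 'rV[R]_d) c t :
  (0 < M)%N -> cell_path mono p q M x y ->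
  (forall k, (k <= M)%N -> enorm (gam v p (x k) - gam w q (y k)) <= c) ->
  0 <= t <= M%:R ->
  enorm (gam v p (gam x M t) - gam w q (gam y M t)) <= c.
Proof.
move=> M0 [_ _ st _] cost /(find_unit M0)[k kM [l hl ->]].
have [[i j] /andP[/andP[/= xi xi'] /andP[/= yj yj']]] := st k kM.
have E z : gam z M (k%:R + l) = (1 - l) * z k + l * z k.+1.
  by rewrite gam_cell// /GRing.scale/=; ring.
(* Each parameter stays in one edge, so the difference vector is the convex combination of its
   values at the two ends of the step. *)
rewrite !E (gam_conv _ (ltn_ord i))// (gam_conv _ (ltn_ord j))//.
rewrite opprD addrACA -!scalerBr; apply: le_trans (enorm_conv _ _ hl) _.
by rewrite ge_max !cost// ltnW.
Qed.

Lemma cell_path_of_mono p q (A B : R -> R) : (0 < p)%N -> (0 < q)%N ->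
  {within `[0, 1], continuous A} -> {within `[0, 1], continuous B} ->
  (A 0 = 0 /\ B 0 = 0) -> (A 1 = p%:R /\ B 1 = q%:R) ->
  (forall s t, 0 <= s -> s <= t -> t <= 1 -> A s <= A t) ->
  (forall s t, 0 <= s -> s <= t -> t <= 1 -> B s <= B t) ->
  exists2 u, (forall k, 0 <= u k <= 1) &
    cell_path true p q (p + q).+1 (A \o u) (B \o u).
Proof.
move=> p0 q0 cA cB [A0 B0] [A1 B1] mA mB.
have hit n (F : R -> R) : {within `[0, 1], continuous F} -> F 0 = 0 ->
    F 1 = n%:R -> exists a : nat -> R, forall i, 0 <= a i <= 1 /\
    ((i <= n)%N -> F (a i) = i%:R).
  move=> cF F0 F1.
  suff /boolp.choice[a ha] : forall i, exists z, 0 <= z <= 1 /\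
      ((i <= n)%N -> F z = i%:R) by exists a.
  move=> i; have [ni|ni] := leqP i n.
    have [|a a01 Fa] := IVT (v := i%:R) (@ler01 R) cF.
      by rewrite F0 F1 min_l ?max_r// ler0n ler_nat.
    by exists a; rewrite -itv01.
  (* Beyond [n] there is no value to reach; 0 is an arbitrary time. *)
  by exists 0; rewrite lexx ler01; split=> //; rewrite leqNgt ni.
have [a ha] := hit p A cA A0 A1; have [b hb] := hit q B cB B0 B1.
pose s := sort <=%R (map a (iota 1 p) ++ map b (iota 1 q)).
have ss : size s = (p + q)%N by rewrite size_sort size_cat !size_map !size_iota.
have s01 z : z \in s -> 0 <= z <= 1.
  by rewrite mem_sort mem_cat => /orP[] /mapP[i _ ->]; [case: (ha i)|case: (hb i)].
(* Time 0 comes first, and the default value 1 supplies the final time at index [(p + q).+1]. *)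
pose u := nth 1 (0 :: s).
have u01 k : 0 <= u k <= 1.
  have [ks|ks] := ltnP k (size (0 :: s)); last first.
    by rewrite /u nth_default// lexx ler01.
  have : u k \in 0 :: s by apply: mem_nth.
  by rewrite inE => /predU1P[->|/s01//]; rewrite lexx ler01.
have uS k : u k <= u k.+1.
  have [ks|ks] := ltnP k.+1 (size (0 :: s)); last first.
    by rewrite {2}/u nth_default//; case/andP: (u01 k).
  apply: (sortedP 1 _) => //=; rewrite path_min_sorted.
    exact: sort_le_sorted.
  by apply/allP => z /s01/andP[].
have u_le : {homo u : i j / (i <= j)%N >-> i <= j}.
  by apply: homo_leq => //; exact: le_trans.
have gap z k : z \in s -> ~ (u k < z < u k.+1).
  move=> /(nthP 1)[m _ <-] /andP[].
  rewrite -[nth 1 s m]/(u m.+1) => h1 h2.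
  have [mk|mk] := leqP m.+1 k; first by have := u_le _ _ mk; lra.
  by have := u_le _ _ mk; lra.
have cell n (F : R -> R) (f : nat -> R) k : (0 < n)%N -> F 0 = 0 ->
    F 1 = n%:R ->
    (forall s t, 0 <= s -> s <= t -> t <= 1 -> F s <= F t) ->
    (forall i, 0 <= f i <= 1 /\ ((i <= n)%N -> F (f i) = i%:R)) ->
    {subset map f (iota 1 n) <= s} ->
    exists i : 'I_n, same_cell (F (u k)) (F (u k.+1)) i.
  move=> n0 F0 F1 mF hf fs.
  have uk := u01 k; have uk1 := u01 k.+1; have ukk := uS k.
  have Fk0 : 0 <= F (u k) by rewrite -{1}F0 mF//; lra.
  have Fkn : F (u k.+1) <= n%:R by rewrite -F1 mF//; lra.
  have Fkk : F (u k) <= F (u k.+1) by rewrite mF//; lra.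
  (* An integer strictly between the two values of [F] would, by monotonicity, put its stopping time
     strictly between [u k] and [u k.+1]. *)
  have [//|//|//||i ni h] := @find_gap _ n (fun k => k%:R) (F (u k)) (F (u k.+1)) n0.
    case=> [|i] ni.
      by move=> /andP[+ _]; rewrite ltNge Fk0.
    have [f01 Ff] := hf i.+1; rewrite -(Ff ni) => /andP[h1 h2].
    apply: (gap (f i.+1) k); first by apply/fs/map_f; rewrite mem_iota.
    by apply/andP; split; rewrite ltNge; apply/negP => h;
      [move: h1|move: h2]; rewrite ltNge mF//; lra.
  exists (Ordinal ni); move: h; rewrite /same_cell/= -natr1.
  by move: Fkk; lra.
have uM : u (p + q).+1 = 1 by rewrite /u nth_default//= ss.
exists u => //; split => /=; rewrite ?A0 ?B0 ?uM//.
- move=> k _.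
  have [|i hi] := cell p A a k p0 A0 A1 mA ha.
    by move=> z zs; rewrite mem_sort mem_cat zs.
  have [|j hj] := cell q B b k q0 B0 B1 mB hb.
    by move=> z zs; rewrite mem_sort mem_cat zs orbT.
  by exists (i, j); apply/andP.
- move=> _ k _; have uk := u01 k; have uk1 := u01 k.+1; have ukk := uS k.
  by rewrite mA ?mB//; lra.
Qed.

(** Continuity within [0, 1] yields relatively closed preimages; a representative closed in [R] can
    be freely intersected and united. *)
Lemma within_closed_preimage (A : R -> R) (l r : R) :
  {within `[0, 1], continuous A} -> exists2 C : set R, closed C &
    forall t, 0 <= t <= 1 -> C t <-> l <= A t <= r.
Proof.
move=> /continuous_closedP/(_ `[l, r]%classic (@itv_closed _ _ l r)) cA.
have /closed_subspaceP[C cC hC] := cA; exists C => // t t01.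
have t01' : t \in `[0, 1] by rewrite itv01.
have [h1 h2] : (C `&` `[0, 1]) t <-> ((A @^-1` `[l, r]) `&` `[0, 1]) t.
  by rewrite hC.
by split=> h; [have [] := h1 (conj h t01')|have [] := h2 (conj h t01')].
Qed.

(** Two cells are joined when the path lies in both at some time. The extracted times are such
    meeting times, possibly out of order, which is admissible since [mono] is false. *)
Lemma cell_path_of_continuous p q (A B : R -> R) : (0 < p)%N -> (0 < q)%N ->
  {within `[0, 1], continuous A} -> {within `[0, 1], continuous B} ->
  (A 0 = 0 /\ B 0 = 0) -> (A 1 = p%:R /\ B 1 = q%:R) ->
  (forall t, 0 <= t <= 1 -> 0 <= A t <= p%:R) ->
  (forall t, 0 <= t <= 1 -> 0 <= B t <= q%:R) ->
  exists2 u, (forall k, 0 <= u k <= 1) &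
    cell_path false p q (p * q) (A \o u) (B \o u).
Proof.
move=> p0 q0 cA cB [A0 B0] [A1 B1] hA hB.
pose C := ('I_p * 'I_q)%type.
pose incell (c : C) t := (c.1%:R <= A t <= c.1%:R + 1) &&
  (c.2%:R <= B t <= c.2%:R + 1).
pose e (c c' : C) := `[< exists2 t, 0 <= t <= 1 & incell c t && incell c' t >].
have cover t : 0 <= t <= 1 -> exists c, incell c t.
  move=> t01.
  have [i ip Ai] := @find_cell _ p (fun k => k%:R) _ p0 (hA t t01).
  have [j jq Bj] := @find_cell _ q (fun k => k%:R) _ q0 (hB t t01).
  by exists (Ordinal ip, Ordinal jq); rewrite /incell /= !natr1 Ai.
have closed_cells (P : pred C) : exists2 D : set R, closed D &
    forall t, 0 <= t <= 1 -> D t <-> exists2 c, P c & incell c t.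
  have /boolp.choice[D hD] : forall c : C, exists D : set R, closed D /\
      forall t, 0 <= t <= 1 -> D t <-> incell c t.
    move=> c; have [D1 cD1 D1A] := within_closed_preimage c.1%:R (c.1%:R + 1) cA.
    have [D2 cD2 D2B] := within_closed_preimage c.2%:R (c.2%:R + 1) cB.
    exists (D1 `&` D2); split; first exact: closedI.
    move=> t t01; split=> [[/(D1A _ t01) h1 /(D2B _ t01) h2]|/andP[h1 h2]].
      exact/andP.
    by split; [apply/(D1A _ t01)|apply/(D2B _ t01)].
  exists (\bigcup_(c in [set c | P c]) D c).
    apply: closed_bigcup; first exact: finite_finset.
    by move=> c _; case: (hD c).
  move=> t t01; split=> [[c /= Pc /((hD c).2 t t01) ?]|[c Pc ct]].
    by exists c.
  by exists c => //; apply/((hD c).2 t t01).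
have o01 : 0 <= (0 : R) <= 1 by rewrite lexx ler01.
have i01 : 0 <= (1 : R) <= 1 by rewrite lexx ler01.
have [c0 c00] := cover 0 o01.
(* The times spent in cells reachable from [c0] and those spent in the other cells form two closed
   sets. A common time would be an edge of [e], so they partition [0, 1], and connectedness leaves
   the second one empty. *)
have [c cc c1] : exists2 c, connect e c0 c & incell c 1.
  have [D cD hD] := closed_cells (connect e c0).
  have [D' cD' hD'] := closed_cells (fun c => ~~ connect e c0 c).
  have DD' t : 0 <= t <= 1 -> D t <-> ~ D' t.
    move=> t01; split.
      move=> /(hD t t01)[c cc ct] /(hD' t t01)[c' /negP cc' c't]; apply: cc'.
      apply: connect_trans cc (connect1 _); apply/asboolP; exists t => //.
      by rewrite ct.
    move=> nD'; have [c ct] := cover t t01; apply/(hD t t01); exists c => //.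
    by apply/negPn/negP => nc; apply/nD'/(hD' t t01); exists c.
  apply/(hD 1 i01).
  suff E : `[0, 1]%classic `&` D = `[0, 1]%classic.
    by have [] : (`[0, 1]%classic `&` D) 1 by rewrite E /= itv01.
  apply: (segment_connected (a := 0) (b := 1)).
  - exists 0; split; first by rewrite /= itv01.
    by apply/(hD 0 o01); exists c0.
  - exists (~` D'); first by rewrite openC.
    apply/seteqP; split=> t [] /=; rewrite itv01 => t01 h; split=> //;
      exact/(DD' t t01).
  - by exists D.
have [s es cs] := connectP cc.
(* A loop-free path visits at most [p * q] cells, whence the length of the cell path. *)
case: (shortenP es) cs => {cc es}s' es us _ cs; rewrite {}cs in c1.
have {}us : ((size s').+1 <= p * q)%N.
  by rewrite -[(size s').+1]/(size (c0 :: s')) -(card_uniqP us)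
    (leq_trans (max_card _))// card_prod !card_ord.
(* [ts] lists a meeting time for each step from cell to cell; past its end the default 1 is a time
   spent in the last cell. *)
have chain b t0 : 0 <= t0 <= 1 -> incell b t0 -> path e b s' ->
    incell (last b s') 1 -> exists ts, [/\ size ts = size s',
    forall k, 0 <= nth 1 (t0 :: ts) k <= 1 &
    forall k, exists c, incell c (nth 1 (t0 :: ts) k) &&
      incell c (nth 1 ts k)].
  elim: s' b t0 {us es c1} => [|c' s' IH] b t0 t01 ct /=.
    move=> _ c1; exists [::]; split=> //; case=> [|k] //=;
      by rewrite ?nth_nil//; exists b; rewrite ?nth_nil ?ct c1.
  move=> /andP[/asboolP[t1 t101 /andP[ct1 c't1]] es] c1.
  have [ts [sz h1 h2]] := IH c' t1 t101 c't1 es c1.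
  exists (t1 :: ts); split; rewrite /= ?sz//; first by case.
  by case=> [|k]; [exists b; rewrite /= ct|exact: h2].
have [ts [sts ts01 hts]] := chain c0 0 o01 c00 es c1.
have uM : nth 1 (0 :: ts) (p * q) = 1 by rewrite nth_default//= sts.
exists (nth 1 (0 :: ts)) => //; split => //=; rewrite ?uM//.
move=> k _; have [b /andP[/andP[a1 b1] /andP[a2 b2]]] := hts k.
by exists b; rewrite /same_cell a1 a2 b1.
Qed.

End CellPath.

(** * Compactness and the existence of an optimal cell path *)

Section OptimalPath.
Variable R : realType.

Lemma closed_le_continuous (T : topologicalType) (f g : T -> R) :
  continuous f -> continuous g -> closed [set z | f z <= g z].
Proof.
move=> cf cg; have -> : [set z | f z <= g z] = (g \- f) @^-1` [set r | 0 <= r].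
  by apply/seteqP; split=> z /=; rewrite subr_ge0.
apply: preimage_closed; last exact: closed_ge.
by move=> z _; apply: continuousB; [exact: cg|exact: cf].
Qed.

Lemma closed_eq_continuous (T : topologicalType) (f g : T -> R) :
  continuous f -> continuous g -> closed [set z | f z = g z].
Proof.
move=> cf cg; have -> : [set z | f z = g z] =
    [set z | f z <= g z] `&` [set z | g z <= f z].
  apply/seteqP; split=> z /=; first by move=> ->; rewrite lexx.
  by case=> h1 h2; apply: le_anti; rewrite h1.
by apply: closedI; exact: closed_le_continuous.
Qed.

(** A continuous function attains its minimum on a compact set. Optimality is phrased through upper
    bounds [c], so that no maximum appears in the statement. *)
Lemma optimal_cell_path mono p q M (D : R -> R -> R) : (0 < M)%N ->
  continuous (fun st : R * R => D st.1 st.2) ->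
  (exists x y : nat -> R, cell_path mono p q M x y) ->
  exists x y : nat -> R, cell_path mono p q M x y /\
    forall x' y' c, cell_path mono p q M x' y' ->
      (forall k, (k <= M)%N -> D (x' k) (y' k) <= c) ->
      forall k, (k <= M)%N -> D (x k) (y k) <= c.
Proof.
move=> M0 cD [x0 [y0 xy0]].
pose T := ('rV[R]_M.+1 * 'rV[R]_M.+1)%type.
(* [inord] is faithful only for [k <= M], the range in which the entries are read. *)
pose X (k : nat) (z : T) : R := z.1 0 (inord k).
pose Y (k : nat) (z : T) : R := z.2 0 (inord k).
have cX k : continuous (X k).
  move=> z; apply: (@continuous_comp _ _ _ fst (fun v : 'rV[R]_M.+1 => v 0 (inord k))).
    exact: cvg_fst.
  exact: coord_continuous.
have cY k : continuous (Y k).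
  move=> z; apply: (@continuous_comp _ _ _ snd (fun v : 'rV[R]_M.+1 => v 0 (inord k))).
    exact: cvg_snd.
  exact: coord_continuous.
have cc (r : R) : continuous (fun _ : T => r) by move=> z; exact: cvg_cst.
pose K := [set z : T | cell_path mono p q M (X ^~ z) (Y ^~ z)].
pose ofseq (x y : nat -> R) : T := (\row_(k < M.+1) x k, \row_(k < M.+1) y k).
have ofseqX x y k : (k <= M)%N -> X k (ofseq x y) = x k.
  by move=> kM; rewrite /X mxE inordK.
have ofseqY x y k : (k <= M)%N -> Y k (ofseq x y) = y k.
  by move=> kM; rewrite /Y mxE inordK.
have Kofseq x y : cell_path mono p q M x y -> K (ofseq x y).
  move=> [h0 hM hc hm]; split; rewrite ?ofseqX ?ofseqY//.
    by move=> k kM; rewrite !ofseqX ?ofseqY ?(ltnW kM)//; exact: hc.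
  by move=> b k kM; rewrite !ofseqX ?ofseqY ?(ltnW kM)//; exact: hm.
have closed_all (P : nat -> set T) : (forall k, closed (P k)) ->
    closed [set z | forall k, (k < M)%N -> P k z].
  move=> cP; have -> : [set z | forall k, (k < M)%N -> P k z] =
      \bigcap_(k in [set k | (k < M)%N]) P k by [].
  by apply: closed_bigI => k _.
have closedK : closed K.
  have -> : K = [set z | X 0%N z = 0] `&` [set z | Y 0%N z = 0] `&`
      [set z | X M z = p%:R] `&` [set z | Y M z = q%:R] `&`
      [set z | forall k, (k < M)%N -> exists c : 'I_p * 'I_q,
        same_cell (X k z) (X k.+1 z) c.1 && same_cell (Y k z) (Y k.+1 z) c.2] `&`
      [set z | mono -> forall k, (k < M)%N ->
         X k z <= X k.+1 z /\ Y k z <= Y k.+1 z].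
    apply/seteqP; split=> z; first by case=> -[? ?] [? ?].
    by case=> -[[[[? ?] ?] ?] ?] ?.
  apply: closedI; last first.
    case: (mono); last first.
      by rewrite (_ : mkset _ = setT); [exact: closedT|apply/seteqP; split].
    rewrite (_ : mkset _ = [set z | forall k, (k < M)%N ->
         ([set z | X k z <= X k.+1 z] `&` [set z | Y k z <= Y k.+1 z]) z]).
      apply: closed_all => k.
      by apply: closedI; apply: closed_le_continuous.
    by apply/seteqP; split=> z /=; [apply|move=> h _; exact: h].
  apply: closedI; last first.
    pose P k := [set z : T | exists c : 'I_p * 'I_q,
      same_cell (X k z) (X k.+1 z) c.1 && same_cell (Y k z) (Y k.+1 z) c.2].
    apply: (closed_all P) => k.
    (* For a fixed cell the condition is a conjunction of weak inequalities, hence closed; there are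
       finitely many cells. *)
    rewrite (_ : P k = \bigcup_(c in [set: 'I_p * 'I_q])
      ([set z | c.1%:R <= X k z] `&` [set z | X k z <= c.1%:R + 1] `&`
       [set z | c.1%:R <= X k.+1 z] `&` [set z | X k.+1 z <= c.1%:R + 1] `&`
       [set z | c.2%:R <= Y k z] `&` [set z | Y k z <= c.2%:R + 1] `&`
       [set z | c.2%:R <= Y k.+1 z] `&` [set z | Y k.+1 z <= c.2%:R + 1])).
      apply: closed_bigcup; first exact: finite_finset.
      by move=> c _; do 7 (apply: closedI; last exact: closed_le_continuous);
        exact: closed_le_continuous.
    apply/seteqP; split=> z /=.
      by case=> c /andP[/andP[/andP[? ?] /andP[? ?]] /andP[/andP[? ?] /andP[? ?]]];
        exists c.
    case=> c _ /= [[[[[[[h1 h2] h3] h4] h5] h6] h7] h8]; exists c.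
    by rewrite /same_cell h1 h2 h3 h4 h5 h6 h7 h8.
  by do 3 (apply: closedI; last exact: closed_eq_continuous);
    exact: closed_eq_continuous.
have compactK : compact K.
  pose box (r : R) : set 'rV[R]_M.+1 := [set v | forall i, `[0, r]%classic (v 0 i)].
  have cbox r : compact (box r).
    by apply: (rV_compact (fun=> @segment_compact R 0 r)).
  apply: (subclosed_compact closedK (compact_setX (cbox p%:R) (cbox q%:R))).
  move=> z Kz; split=> i /=; rewrite in_itv/= -(inord_val i).
    by apply: (cell_path_itv Kz); rewrite -ltnS.
  by apply: (cell_path_itv (cell_path_sym Kz)); rewrite -ltnS.
(* As [D] may be negative, the maximum starts from the cost at index 0 rather than from 0. *)
pose cost (z : T) := \big[Num.max/D (X 0%N z) (Y 0%N z)]_(k < M.+1) D (X k z) (Y k z).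
have cDXY k : continuous (fun z => D (X k z) (Y k z)).
  move=> z; apply: (@continuous2_cvg _ _ _ _ _ _ (X k) (Y k) D).
  - exact: (cD (X k z, Y k z)).
  - exact: cX.
  - exact: cY.
have ccost : continuous cost.
  rewrite /cost; elim: (index_enum _) => [|k s IH] z.
    by under eq_fun do rewrite big_nil; exact: cDXY.
  under eq_fun do rewrite big_cons.
  by apply: continuous_max; [exact: cDXY|exact: IH].
have cost_ge z k : (k <= M)%N -> D (X k z) (Y k z) <= cost z.
  move=> kM; have kM' : (k < M.+1)%N by [].
  exact: (@le_bigmax _ _ _ _ (fun k : 'I_M.+1 => D (X k z) (Y k z)) (Ordinal kM')).
have [| |z Kz zmin] := compact_EVT_min (f := cost) _ compactK.
- by exists (ofseq x0 y0); exact: Kofseq.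
- exact: continuous_subspaceT.
exists (X ^~ z), (Y ^~ z); split; first by move: Kz; rewrite inE.
move=> x y c xy hc k kM; apply: le_trans (cost_ge z k kM) _.
apply: le_trans (zmin (ofseq x y) _) _; first by rewrite inE; exact: Kofseq.
apply/bigmax_leP; split=> [|i _]; rewrite ofseqX ?ofseqY ?hc// -ltnS//.
Qed.

End OptimalPath.

(** * Comparing cell paths with reparametrizations *)

Section FrechetCellPath.
Variables (R : realType) (d : nat) (sigma tau : R -> 'rV[R]_d).
Variables vs vt : seq 'rV[R]_d.
Hypotheses (psigma : polyline sigma vs) (ptau : polyline tau vt).

Let p := (size vs).-1.
Let q := (size vt).-1.

Definition cell_dist (s t : R) : R :=
  enorm (gam (nth 0 vs) (size vs).-1 s - gam (nth 0 vt) (size vt).-1 t).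

Lemma continuous_cell_dist :
  continuous (fun st : R * R => cell_dist st.1 st.2).
Proof.
move=> st; rewrite /cell_dist.
have cfst : {for st, continuous (fun st : R * R => gam (nth 0 vs) p st.1)}.
  apply: (@continuous_comp _ _ _ fst (gam (nth 0 vs) p)); first exact: cvg_fst.
  exact: gam_continuous.
have csnd : {for st, continuous (fun st : R * R => gam (nth 0 vt) q st.2)}.
  apply: (@continuous_comp _ _ _ snd (gam (nth 0 vt) q)); first exact: cvg_snd.
  exact: gam_continuous.
have /continuous_comp := continuousB cfst csnd; apply; exact: continuous_enorm.
Qed.

Lemma size_polyline_gt1 : (1 < size vs)%N /\ (1 < size vt)%N.
Proof.
have [? [p0 _ _ _] _] := polyline_param psigma.
by have [? [q0 _ _ _] _] := polyline_param ptau; lia.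
Qed.

(** Composition with [theta] gives a path of edge parameters. Sampling it at common times [u k]
    picks values from the set whose supremum is the matching cost. *)
Lemma cell_path_of_reparam (mono : bool) (a b : R -> R) :
  weak_reparam a -> weak_reparam b -> (mono -> bij_reparam a /\ bij_reparam b) ->
  exists x y : nat -> R, cell_path mono p q (if mono then (p + q).+1 else p * q)%N x y /\
    forall k, cell_dist (x k) (y k) <= matching_cost sigma tau a b.
Proof.
move=> wa wb ab.
have [t tp [sigmaE _]] := polyline_param psigma.
have [s sq [tauE _]] := polyline_param ptau.
have [p0 _ _ t_lt] := tp; have [q0 _ _ s_lt] := sq.
have [ca a01 a0 a1] := wa; have [cb b01 b0 b1] := wb.
have {}a01 u : 0 <= u <= 1 -> 0 <= a u <= 1 by rewrite -!itv01; exact: a01.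
have {}b01 u : 0 <= u <= 1 -> 0 <= b u <= 1 by rewrite -!itv01; exact: b01.
have cta : {within `[0, 1], continuous (theta t p \o a)}.
  by apply: within_continuous_comp => // ? _; exact: theta_continuous.
have csb : {within `[0, 1], continuous (theta s q \o b)}.
  by apply: within_continuous_comp => // ? _; exact: theta_continuous.
have E0 : (theta t p \o a) 0 = 0 /\ (theta s q \o b) 0 = 0.
  by rewrite /= a0 b0 !theta0.
have E1 : (theta t p \o a) 1 = p%:R /\ (theta s q \o b) 1 = q%:R.
  by rewrite /= a1 b1 !theta1.
have costE u : 0 <= u <= 1 ->
    enorm (sigma (a u) - tau (b u)) = cell_dist (theta t p (a u)) (theta s q (b u)).
  by move=> u01; rewrite sigmaE ?tauE ?a01 ?b01.
suff [u u01 xy] : exists2 u, (forall k, 0 <= u k <= 1) &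
    cell_path mono p q (if mono then (p + q).+1 else p * q)%N
      (theta t p \o a \o u) (theta s q \o b \o u).
  exists (theta t p \o a \o u), (theta s q \o b \o u); split=> // k.
  rewrite /= -costE//; apply: le_matching_cost (u01 k) => r r01.
  rewrite costE//; apply: le_trans (enormD _ _) _; rewrite enormN.
  by apply: lerD; exact: gam_bounded.
case: mono ab => [/(_ isT)[ba bb]|_].
  have mon (g : R -> R) : bij_reparam g -> forall x y,
      0 <= x -> x <= y -> y <= 1 -> g x <= g y.
    move=> bg x y x0; rewrite le_eqVlt => /predU1P[->//|xy] y1.
    exact/ltW/(bij_reparam_lt bg).
  apply: cell_path_of_mono => // x y x0 xy y1; apply: theta_le => //;
    exact: mon.
by apply: cell_path_of_continuous => // r r01; apply: theta_itv => //;
  [exact: a01|exact: b01].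
Qed.

Variables (M : nat) (x y : nat -> R) (c : R).
Hypotheses (M0 : (0 < M)%N)
  (cost_xy : forall k, (k <= M)%N -> cell_dist (x k) (y k) <= c).

(** The affine interpolation of [z], with index [k] reached at time [k / M]. *)
Let alpha (z : nat -> R) (u : R) := gam z M (M%:R * u).

Let scale_itv (u : R) : 0 <= u <= 1 -> 0 <= M%:R * u <= M%:R.
Proof. by move=> /andP[u0 u1]; rewrite mulr_ge0//= ler_piMr. Qed.

Let continuous_alpha z : continuous (alpha z).
Proof.
move=> u; have /continuous_comp : {for u, continuous (fun u : R => M%:R * u)}.
  by apply: cvgMl_tmp; exact: cvg_id.
by apply; exact: gam_continuous.
Qed.

Let alpha0 z : alpha z 0 = z 0%N.
Proof. by rewrite /alpha mulr0 (gam_nat _ (leq0n M)). Qed.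

Let alpha1 z : alpha z 1 = z M.
Proof. by rewrite /alpha mulr1 gam_nat. Qed.

(** The interpolated path, pulled back by [gam t] and [gam s], is a pair of weak reparametrizations
    whose cost is controlled at the indices. *)
Lemma weak_frechet_le_cell_path (mono : bool) : cell_path mono p q M x y ->
  weak_frechet sigma tau <= c.
Proof.
move=> xy.
have [t tp [_ sigmaE]] := polyline_param psigma.
have [s sq [_ tauE]] := polyline_param ptau.
have [[x0 y0] [xM yM] _ _] := xy.
have itvx u : 0 <= u <= 1 -> 0 <= alpha x u <= p%:R.
  by move=> u01; exact: gam_cell_path_itv M0 xy (scale_itv u01).
have itvy u : 0 <= u <= 1 -> 0 <= alpha y u <= q%:R.
  by move=> u01; exact: gam_cell_path_itv M0 (cell_path_sym xy) (scale_itv u01).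
have wx : weak_reparam (gam t p \o alpha x).
  by apply: weak_reparam_gam; rewrite ?alpha0 ?alpha1.
have wy : weak_reparam (gam s q \o alpha y).
  by apply: weak_reparam_gam; rewrite ?alpha0 ?alpha1.
apply: le_trans (weak_frechet_le _ _ wx wy) _; apply: matching_cost_le => u u01.
rewrite /= sigmaE ?tauE ?itvx ?itvy//.
exact: cell_path_cost M0 xy cost_xy (scale_itv u01).
Qed.

(* A monotone cell path only gives nondecreasing reparametrizations; blending
   them with the identity makes them bijective, at an arbitrarily small cost
   because the curves are Lipschitz. *)
Lemma frechet_le_cell_path : cell_path true p q M x y ->
  frechet sigma tau <= c.
Proof.
move=> xy; apply/ler_addgt0Pr => e e0.
have [t tp [_ sigmaE]] := polyline_param psigma.
have [s sq [_ tauE]] := polyline_param ptau.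
have [p0 _ _ _] := tp; have [q0 _ _ _] := sq.
have [[x0 y0] [xM yM] _ /(_ isT) mxy] := xy.
set v := nth 0 vs; set w := nth 0 vt.
(* Moving each parameter by at most [eta] times the length of its range changes the difference
   vector by at most [eta * L]. *)
pose L := (\sum_(i < p) enorm (v i.+1 - v i)) * p%:R +
          (\sum_(i < q) enorm (w i.+1 - w i)) * q%:R.
have L0 : 0 <= L.
  by apply: addr_ge0; apply: mulr_ge0 => //; apply: sumr_ge0 => i _;
    exact: enorm_ge0.
(* Adding [e] to the denominator covers [L = 0] and keeps [eta] at most 1, while [eta * L <= e]. *)
pose eta := e / (L + e).
have eta0 : 0 < eta by rewrite divr_gt0//; lra.
have eta1 : eta <= 1 by rewrite ler_pdivrMr; lra.
have etaL : eta * L <= e by rewrite mulrAC ler_pdivrMr; nra.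
(* The uniform motion [n%:R * u] provides strict growth and has the same end values as the path. *)
pose blend n z (u : R) := (1 - eta) * alpha z u + eta * (n%:R * u).
have cblend n z : continuous (blend n z).
  move=> u; apply: cvgD; apply: cvgMl_tmp; first exact: continuous_alpha.
  by apply: cvgMl_tmp; exact: cvg_id.
have blend_lt n z : (0 < n)%N -> (forall k, (k < M)%N -> z k <= z k.+1) ->
    forall u r, 0 <= u -> u < r -> r <= 1 -> blend n z u < blend n z r.
  move=> n0 mz u r u0 ur r1; apply: ler_ltD.
    by apply: ler_wpM2l; rewrite ?subr_ge0// gam_le// ler_wpM2l// ltW.
  by rewrite ltr_pM2l// ltr_pM2l// ltr0n.
have blend_close n z u : 0 <= u <= 1 -> 0 <= alpha z u <= n%:R ->
    `|blend n z u - alpha z u| <= eta * n%:R.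
  move=> u01 zn; have -> : blend n z u - alpha z u = eta * (n%:R * u - alpha z u).
    by rewrite /blend; ring.
  rewrite normrM gtr0_norm// ler_pM2l// ler_norml.
  have n0 : 0 <= n%:R :> R by [].
  have : 0 <= n%:R * u <= n%:R by nra.
  lra.
have itvx u : 0 <= u <= 1 -> 0 <= alpha x u <= p%:R.
  by move=> u01; exact: gam_cell_path_itv M0 xy (scale_itv u01).
have itvy u : 0 <= u <= 1 -> 0 <= alpha y u <= q%:R.
  by move=> u01; exact: gam_cell_path_itv M0 (cell_path_sym xy) (scale_itv u01).
have bx0 : blend p x 0 = 0 by rewrite /blend alpha0 x0 !mulr0 addr0.
have by0 : blend q y 0 = 0 by rewrite /blend alpha0 y0 !mulr0 addr0.
have bx1 : blend p x 1 = p%:R by rewrite /blend alpha1 xM; ring.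
have by1 : blend q y 1 = q%:R by rewrite /blend alpha1 yM; ring.
have mx k : (k < M)%N -> x k <= x k.+1 by case/mxy.
have my k : (k < M)%N -> y k <= y k.+1 by case/mxy.
have bx := bij_reparam_gam tp (cblend p x) bx0 bx1 (blend_lt p x p0 mx).
have by_ := bij_reparam_gam sq (cblend q y) by0 by1 (blend_lt q y q0 my).
apply: le_trans (frechet_le _ _ bx by_) _; apply: matching_cost_le => u u01.
have blend_itv n z : (0 < n)%N -> (forall k, (k < M)%N -> z k <= z k.+1) ->
    blend n z 0 = 0 -> blend n z 1 = n%:R -> 0 <= blend n z u <= n%:R.
  move=> n0 mz z0 z1; rewrite -{1}z0 -z1.
  have le i j : 0 <= i -> i <= j -> j <= 1 -> blend n z i <= blend n z j.
    move=> i0; rewrite le_eqVlt => /predU1P[->//|ij] j1.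
    by rewrite ltW// blend_lt.
  by case/andP: u01 => u0 u1; rewrite !le.
rewrite /= sigmaE ?tauE ?blend_itv//.
rewrite -/p -/q -/v -/w.
set X := blend p x u; set Y := blend q y u.
(* The difference along the unblended path, plus one Lipschitz error for each curve. *)
have -> : gam v p X - gam w q Y =
    (gam v p (alpha x u) - gam w q (alpha y u)) +
    ((gam v p X - gam v p (alpha x u)) - (gam w q Y - gam w q (alpha y u))).
  by rewrite [RHS]addrACA -opprD !subrKC.
apply: le_trans (enormD _ _) _; apply: lerD.
  exact: cell_path_cost M0 xy cost_xy (scale_itv u01).
apply: le_trans etaL; apply: le_trans (enormD _ _) _; rewrite enormN.
rewrite /L mulrDr; apply: lerD; apply: le_trans (gam_lipschitz _ _ _ _) _;
  rewrite mulrCA; apply: ler_wpM2l; rewrite ?blend_close ?itvx ?itvy//;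
  by apply: sumr_ge0 => i _; exact: enorm_ge0.
Qed.

End FrechetCellPath.

(** * Optimal cell paths under a linear embedding *)

(** Every admissible pair of reparametrizations yields a cell path of the same length [M], so an
    optimal one costs at most every matching and hence at most the infimum. The identity pair shows
    that cell paths exist. *)
Lemma optimal_frechet_cell_path (R : realType) (d : nat)
    (sigma tau : R -> 'rV[R]_d) (vs vt : seq 'rV[R]_d) (mono : bool) :
  polyline sigma vs -> polyline tau vt ->
  let p := (size vs).-1 in let q := (size vt).-1 in
  let M := (if mono then (p + q).+1 else p * q)%N in
  exists x y : nat -> R, cell_path mono p q M x y /\
    forall k, (k <= M)%N -> cell_dist vs vt (x k) (y k) <=
      if mono then frechet sigma tau else weak_frechet sigma tau.
Proof.
move=> ps pt p q M.
have [ss st] := size_polyline_gt1 ps pt.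
have M0 : (0 < M)%N by rewrite /M; case: (mono) => //; rewrite /p /q; nia.
have [] := @optimal_cell_path R mono p q M (cell_dist vs vt) M0.
- exact: continuous_cell_dist.
- have [|||x [y [xy _]]] := @cell_path_of_reparam _ _ _ _ _ _ ps pt mono id id.
  + exact: weak_reparam_id.
  + exact: weak_reparam_id.
  + by split; exact: bij_reparam_id.
  + by exists x, y.
move=> x [y [xy opt]]; exists x, y; split=> // k kM.
have main a b : weak_reparam a -> weak_reparam b ->
    (mono -> bij_reparam a /\ bij_reparam b) ->
    cell_dist vs vt (x k) (y k) <= matching_cost sigma tau a b.
  move=> wa wb ab.
  have [x' [y' [xy' cost]]] := cell_path_of_reparam ps pt wa wb ab.
  by apply: opt xy' _ _ kM => i _; exact: cost.
case: (mono) main => main.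
- by apply: le_frechet => a b ba bb; apply: main => //; exact: bij_weak_reparam.
- by apply: le_weak_frechet => a b wa wb; exact: main.
Qed.

(** By linearity, a point of an image curve is the image under [f] of the point with the same
    parameter, so the upper embedding bound applies to two points of [P]. *)
Lemma cell_dist_embedding (R : realType) (d d' : nat) (eps : R)
    (P : set 'rV[R]_d) (f : {linear 'rV[R]_d -> 'rV[R]_d'})
    (vs vt : seq 'rV[R]_d) (s t : R) :
  is_embedding eps P f ->
  (0 < size vs)%N -> (0 < size vt)%N ->
  P (gam (nth 0 vs) (size vs).-1 s) -> P (gam (nth 0 vt) (size vt).-1 t) ->
  cell_dist (map f vs) (map f vt) s t <= (1 + eps) * cell_dist vs vt s t.
Proof.
move=> ef vs0 vt0 Ps Pt; rewrite /cell_dist !size_map.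
have E ws r : (0 < size ws)%N ->
    gam (nth 0 (map f ws)) (size ws).-1 r = f (gam (nth 0 ws) (size ws).-1 r).
  move=> ws0; rewrite gam_linear; apply: eq_gam => i iw.
  (* Nonemptiness turns [i <= (size ws).-1] into [i < size ws], which [nth_map] requires. *)
  by rewrite /= (nth_map 0)//; case: (size ws) ws0 iw.
by rewrite !E//; have /andP[] := ef _ _ Ps Pt.
Qed.

Theorem lemma10 (R : realType) :
  exists C : nat,
  forall (d : nat) (sigma tau : R -> 'rV[R]_d) (vs vt : seq 'rV[R]_d),
    polygonal sigma vs -> polygonal tau vt ->
  exists P' : {fset 'rV[R]_d},
    (#|` P'| <= C * (size vs ^ 2 * size vt + size vt ^ 2 * size vs))%N /\
    forall (eps : R) (d' : nat) (f : {linear 'rV[R]_d -> 'rV[R]_d'}),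
      0 < eps < 1 ->
      is_embedding eps ([set` vs] `|` [set` vt] `|` [set` P']) f ->
    forall sigma' tau' : R -> 'rV[R]_d',
      polyline sigma' (map f vs) -> polyline tau' (map f vt) ->
      weak_frechet sigma' tau' <= (1 + eps) * weak_frechet sigma tau /\
      frechet sigma' tau' <= (1 + eps) * frechet sigma tau.
Proof.
(* With [m] and [n] vertices, the two paths contribute [2 * (p * q + 1) + 2 * (p + q + 2) = 2 * (m *
   n + 2)] listed points, which is within twice the cubic bound because [m] and [n] are at least
   2. *)
exists 2 => d sigma tau vs vt [ps _] [pt _].
have [ss st] := size_polyline_gt1 ps pt.
have [x [y [xy cost_xy]]] := optimal_frechet_cell_path false ps pt.
have [z [w [zw cost_zw]]] := optimal_frechet_cell_path true ps pt.
move: xy cost_xy zw cost_zw; set p := (size vs).-1; set q := (size vt).-1.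
set M := (p * q)%N; set N := (p + q).+1 => xy cost_xy zw cost_zw.
pose pts (ws : seq 'rV[R]_d) (u : nat -> R) m :=
  [seq gam (nth 0 ws) (size ws).-1 (u k) | k <- iota 0 m.+1].
(* Both optimal paths are recorded on both curves before [eps] and [f] are introduced, so the points
   depend on the curves alone. *)
pose s := pts vs x M ++ pts vt y M ++ pts vs z N ++ pts vt w N.
have pts_s ws u m k : (k <= m)%N -> {subset pts ws u m <= s} ->
    gam (nth 0 ws) (size ws).-1 (u k) \in [fset r in s]%fset.
  by move=> km sub; rewrite in_fset; apply: sub; apply/mapP; exists k; rewrite ?mem_iota.
have M0 : (0 < M)%N by rewrite /M /p /q; nia.
exists [fset r in s]%fset; split.
  rewrite card_fseq; apply: leq_trans (size_undup _) _.
  rewrite /s !size_cat !size_map !size_iota /M /N /p /q.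
  case: (size vs) ss => [|[|a]]// _; case: (size vt) st => [|[|b]]// _.
  by rewrite !expnS !expn0 /=; nia.
move=> eps d' f /andP[eps0 _] ef sigma' tau' ps' pt'.
have fcost m u r mu c : (mu <= m)%N ->
    {subset pts vs u m <= s} -> {subset pts vt r m <= s} ->
    cell_dist vs vt (u mu) (r mu) <= c ->
    cell_dist (map f vs) (map f vt) (u mu) (r mu) <= (1 + eps) * c.
  move=> km su sr uc; apply: le_trans (cell_dist_embedding ef _ _ _ _) _.
  - exact: ltnW.
  - exact: ltnW.
  - by right; exact: pts_s km su.
  - by right; exact: pts_s km sr.
  - by apply: ler_wpM2l => //; lra.
split.
(* The image curves have as many vertices as the originals, so the same cell path is valid for
   them. *)
- apply: (weak_frechet_le_cell_path ps' pt' M0 _); last by rewrite !size_map; exact: xy.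
  move=> k kM; apply: (fcost M) => //; last exact: cost_xy.
    by move=> r rs; rewrite /s !mem_cat rs.
  by move=> r rs; rewrite /s !mem_cat rs !orbT.
- apply: (frechet_le_cell_path ps' pt' (ltn0Sn _) _); last by rewrite !size_map; exact: zw.
  move=> k kN; apply: (fcost N) => //; last exact: cost_zw.
    by move=> r rs; rewrite /s !mem_cat rs !orbT.
  by move=> r rs; rewrite /s !mem_cat rs !orbT.
Qed.
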